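(* Fix $t\in\mathbb{C}$. The Boltzmann weights (Gamma-Gamma ice) $$a_1(i,j)=tz_i+z_j,\quad a_2(i,j)=tz_j+z_i,\quad b_1(i,j)=t(z_j-z_i),\quad b_2(i,j)=z_i-z_j,\quad c_1(i,j)=(t+1)z_i,\quad c_2(i,j)=(t+1)z_j$$ satisfy the Yang–Baxter equation: for all labels $i,j,k$, all $z_i,z_j,z_k\in\mathbb{C}$ and every orientation $\sigma$ of the six external edges, $Z_A(\sigma)=Z_B(\sigma)$.
   Context: Six-vertex conventions. Lines are drawn in the plane; each line carries a label $\ell$ with a spectral parameter $z_\ell\in\mathbb{C}$. Every edge is oriented either ''left'' or ''right''. A vertex is a transversal crossing of an ascending line (lower left to upper right) with label $p$ and a descending line (upper left to lower right) with label $q$; its edges are BL, TR on the ascending line and TL, BR on the descending line. Admissible types: $a_1$: all four edges point left; $a_2$: all point right; $b_1$: BL, TR left and TL, BR right; $b_2$: BL, TR right and TL, BR left; $c_1$: TL, TR left and BL, BR right; $c_2$: TL, TR right and BL, BR left. A vertex of type $x$ has weight $x(p,q)$; other configurations have weight $0$. Networks. For labels $i,j,k$: external edges $L_k,L_j,L_i$ (left ends) and $R_i,R_j,R_k$ (right ends). Network A: internal edges $e_i,e_j,e_k$; vertex $V_1$ with labels $(p,q)=(j,k)$, BL$=L_j$, TL$=L_k$, TR$=e_j$, BR$=e_k$; $V_2$ with $(i,k)$, BL$=L_i$, TL$=e_k$, TR$=e_i$, BR$=R_k$; $V_3$ with $(i,j)$, BL$=e_i$, TL$=e_j$, TR$=R_i$,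 BR$=R_j$. Network B: internal edges $f_i,f_j,f_k$; $W_1$ with $(i,j)$, BL$=L_i$, TL$=L_j$, TR$=f_i$, BR$=f_j$; $W_2$ with $(i,k)$, BL$=f_i$, TL$=L_k$, TR$=R_i$, BR$=f_k$; $W_3$ with $(j,k)$, BL$=f_j$, TL$=f_k$, TR$=R_j$, BR$=R_k$. $Z_A(\sigma)$, $Z_B(\sigma)$ denote the sums over internal edge orientations of the products of the three vertex weights. *)

(* Defs.v *)
From HB Require Import structures.
From mathcomp Require Import all_boot all_order all_algebra.
From mathcomp Require Import complex reals.

Set Implicit Arguments.
Unset Strict Implicit.
Unset Printing Implicit Defensive.

Import GRing.Theory.
Local Open Scope ring_scope.
Local Open Scope complex_scope.

Inductive orientation : predArgType := PointsLeft | PointsRight.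

Definition bool_of_orientation (o : orientation) : bool :=
  if o is PointsRight then true else false.
Definition orientation_of_bool (b : bool) : orientation :=
  if b then PointsRight else PointsLeft.
Lemma bool_of_orientationK : cancel bool_of_orientation orientation_of_bool.
Proof. by case. Qed.
HB.instance Definition _ := Finite.copy orientation (can_type bool_of_orientationK).

(* The three lines of a network.  Lines are kept apart from the labels that
   they carry: distinct lines may carry the same label. *)
Inductive line : predArgType := line_i | line_j | line_k.

Definition ord_of_line (l : line) : 'I_3 :=
  match l with
  | line_i => inord 0
  | line_j => inord 1
  | line_k => inord 2
  end.
Definition line_of_ord (n : 'I_3) : line := nth line_k [:: line_i; line_j] n.
Lemma ord_of_lineK : cancel ord_of_line line_of_ord.
Proof. by case; rewrite /line_of_ord inordK. Qed.
HB.instance Definition _ := Finite.copy line (can_type ord_of_lineK).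

(* Each line meets the two others, hence is cut into three edges: a left end,
   an internal edge and a right end. *)
Inductive external_edge : Type := LeftEnd of line | RightEnd of line.
Inductive edge : Type := Ext of external_edge | Int of line.

Definition L_ (l : line) : edge := Ext (LeftEnd l).
Definition R_ (l : line) : edge := Ext (RightEnd l).

Inductive vertex_type : Type := a1 | a2 | b1 | b2 | c1 | c2.

Definition vertex_type_of (BL TL TR BR : orientation) : option vertex_type :=
  match BL, TL, TR, BR with
  | PointsLeft,  PointsLeft,  PointsLeft,  PointsLeft  => Some a1
  | PointsRight, PointsRight, PointsRight, PointsRight => Some a2
  | PointsLeft,  PointsRight, PointsLeft,  PointsRight => Some b1
  | PointsRight, PointsLeft,  PointsRight, PointsLeft  => Some b2
  | PointsRight, PointsLeft,  PointsLeft,  PointsRight => Some c1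
  | PointsLeft,  PointsRight, PointsRight, PointsLeft  => Some c2
  | _, _, _, _ => None
  end.

(* BL and TR lie on the ascending line, TL and BR on the descending one. *)
Record vertex : Type := Vertex {
  ascending : line;
  descending : line;
  BL : edge;
  TL : edge;
  TR : edge;
  BR : edge
}.

Definition network : Type := seq vertex.

Definition networkA : network :=
  [:: Vertex line_j line_k (L_ line_j) (L_ line_k) (Int line_j) (Int line_k);
      Vertex line_i line_k (L_ line_i) (Int line_k) (Int line_i) (R_ line_k);
      Vertex line_i line_j (Int line_i) (Int line_j) (R_ line_i) (R_ line_j)].

Definition networkB : network :=
  [:: Vertex line_i line_j (L_ line_i) (L_ line_j) (Int line_i) (Int line_j);
      Vertex line_i line_k (Int line_i) (L_ line_k) (R_ line_i) (Int line_k);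
      Vertex line_j line_k (Int line_j) (Int line_k) (R_ line_j) (R_ line_k)].

Section PartitionFunction.
Variables (S : pzSemiRingType) (label : Type).
Variable weight : vertex_type -> label -> label -> S.

Definition vertex_weight (lab : line -> label) (state : edge -> orientation)
    (v : vertex) : S :=
  if vertex_type_of (state (BL v)) (state (TL v)) (state (TR v)) (state (BR v))
    is Some x then weight x (lab (ascending v)) (lab (descending v)) else 0.

Definition join_state (sigma : external_edge -> orientation)
    (tau : line -> orientation) (e : edge) : orientation :=
  match e with Ext x => sigma x | Int l => tau l end.

Definition partition_function (N : network) (lab : line -> label)
    (sigma : external_edge -> orientation) : S :=
  \sum_(tau : {ffun line -> orientation})
    \prod_(v <- N) vertex_weight lab (join_state sigma tau) v.

End PartitionFunction.

Definition labelling (label : Type) (i j k : label) (l : line) : label :=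
  match l with line_i => i | line_j => j | line_k => k end.

Definition gamma_gamma_weight (R : realType) (label : Type) (t : R[i])
    (z : label -> R[i]) (x : vertex_type) (p q : label) : R[i] :=
  match x with
  | a1 => t * z p + z q
  | a2 => t * z q + z p
  | b1 => t * (z q - z p)
  | b2 => z p - z q
  | c1 => (t + 1) * z p
  | c2 => (t + 1) * z q
  end.

(* Main.v *)
Require Import Defs.
From mathcomp Require Import all_boot all_order all_algebra.
From mathcomp Require Import complex reals.
From mathcomp Require Import ring.

Import GRing.Theory.
Local Open Scope ring_scope.
Local Open Scope complex_scope.

(** For a fixed boundary, each side is a sum over eight internal states, hence an explicit
    polynomial in [t], [z i], [z j], [z k]. Every admissible vertex has as many right-pointing edges
    on its left as on its right, so both sides vanish unless the boundary is balanced in the same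
    way; the 20 balanced boundaries give polynomial identities. [partition_functionE] and
    [sum_orientation] make the eight terms explicit. *)

Lemma sum_orientation (V : nmodType) (F : orientation -> V) :
  \sum_o F o = F PointsLeft + F PointsRight.
Proof.
rewrite (reindex orientation_of_bool) /=; first by rewrite big_bool /= addrC.
by exists bool_of_orientation => [[]|[]].
Qed.

(** A state is the triple of its values on the three lines. The finite function built from a triple
    agrees with [labelling] only pointwise, whence [Fext]; [labelling] is preferred because it
    computes. *)
Lemma sum_ffun_line (T : finType) (V : nmodType) (F : (line -> T) -> V)
    (Fext : forall f g, f =1 g -> F f = F g) :
  \sum_(tau : {ffun line -> T}) F tau =
  \sum_a \sum_b \sum_c F (labelling a b c).
Proof.
under [RHS]eq_bigr do rewrite pair_bigA /=.
rewrite pair_bigA /=.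
rewrite (reindex (fun p : T * (T * T) =>
  [ffun l => labelling p.1 p.2.1 p.2.2 l])) /=.
  by apply: eq_bigr => p _; apply: Fext => l; rewrite ffunE.
exists (fun f : {ffun line -> T} => (f line_i, (f line_j, f line_k))).
  by move=> [a [b c]] _; rewrite !ffunE.
by move=> f _; apply/ffunP=> -[]; rewrite ffunE.
Qed.

Lemma partition_functionE (S : pzSemiRingType) (label : Type)
    (weight : vertex_type -> label -> label -> S) (N : network)
    (lab : line -> label) (sigma : external_edge -> orientation) :
  partition_function weight N lab sigma =
  \sum_a \sum_b \sum_c
    \prod_(v <- N) vertex_weight weight lab
                     (join_state sigma (labelling a b c)) v.
Proof.
apply: (sum_ffun_line _ _ (fun tau : line -> orientation =>
  \prod_(v <- N) vertex_weight weight lab (join_state sigma tau) v)) => f g fg.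
have fgE e : join_state sigma f e = join_state sigma g e by case: e => /=.
by apply: eq_bigr => v _; rewrite /vertex_weight !fgE.
Qed.

Theorem theorem3p1 (R : realType) (t : R[i]) (label : Type)
    (z : label -> R[i]) (i j k : label)
    (sigma : external_edge -> orientation) :
  partition_function (gamma_gamma_weight t z) networkA (labelling i j k) sigma =
  partition_function (gamma_gamma_weight t z) networkB (labelling i j k) sigma.
Proof.
rewrite !partition_functionE !sum_orientation /networkA /networkB.
rewrite !big_cons !big_nil /vertex_weight /=.
(* With all 64 boundaries fixed, every [vertex_type_of] evaluates and inadmissible vertices become
   0; what remains is polynomial in [t] and the three parameters. *)
case: (sigma (LeftEnd line_i)); case: (sigma (LeftEnd line_j));
case: (sigma (LeftEnd line_k)); case: (sigma (RightEnd line_i));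
case: (sigma (RightEnd line_j)); case: (sigma (RightEnd line_k));
  rewrite /=; ring.
Qed.
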